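(* There exists a ${}^\star$-free formula $\phi$ of the logic of graph modifiers such that for all ${}^\star$-free formulas $\psi$ in which no update action occurs, $\mathcal{C}_{all}\not\models\phi\leftrightarrow\psi$; that is, for every such $\psi$ there is a rooted termgraph $G$ in which $\phi\leftrightarrow\psi$ is false.
   Context: **Syntax.** Let $\mathcal{F}$ (edge labels $a,b,\dots$) and $\Omega$ (node labels $\omega,\pi,\dots$) be countably infinite sets. Actions $\alpha,\beta$ and formulas $\phi,\psi$ are defined by mutual recursion: $\alpha ::= a \mid U \mid n \mid \vec{n} \mid \phi? \mid (\omega:=_g\phi) \mid (\omega:=_l\phi) \mid (a+(\phi,\psi)) \mid (a-(\phi,\psi)) \mid (\alpha;\beta) \mid (\alpha\cup\beta) \mid \alpha^\star$, $\phi ::= \omega \mid \bot \mid \neg\phi \mid (\phi\vee\psi) \mid [\alpha]\phi$, with $a\in\mathcal{F}$, $\omega\in\Omega$. Other Boolean connectives are abbreviations, and $\langle\alpha\rangle\phi:=\neg[\alpha]\neg\phi$. The update actions are those of the forms $n$, $\vec{n}$, $\omega:=_g\phi$, $\omega:=_l\phi$, $a+(\phi,\psi)$, $a-(\phi,\psi)$. A formula is ${}^\star$-free if ${}^\star$ does not occur in it. ''Occurs'' refers to occurrence at any depth, including inside formulas that are nested in actions. **Rooted termgraphs.** A rooted termgraph is $G=(\mathcal{N},\mathcal{E},\mathcal{L}^n,\mathcal{L}^e,\mathcal{S},\mathcal{T},n_0)$ with a set of nodes $\mathcal{N}$, a set of edges $\mathcal{E}$, node labelling $\mathcal{L}^n:\mathcal{N}\to\mathcal{P}(\Omega)$,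 edge labelling $\mathcal{L}^e:\mathcal{E}\to\mathcal{F}$, source and target maps $\mathcal{S},\mathcal{T}:\mathcal{E}\to\mathcal{N}$, and root $n_0\in\mathcal{N}$. $\mathcal{C}_{all}$ is the class of all rooted termgraphs. An edge $(m,a,m')$ means an edge labelled $a$ with source $m$ and target $m'$. Write $G_m$ for $G$ with its root replaced by $m$. **Semantics.** $G\models\omega$ iff $\omega\in\mathcal{L}^n(n_0)$; $\bot,\neg,\vee$ as usual; $G\models[\alpha]\phi$ iff $G'\models\phi$ for all rooted termgraphs $G'$ with $G\to_\alpha G'$, where (components not mentioned, including the root, are unchanged): - $G\to_a G'$: only the root changes, to some $n_0'$ such that there is an edge $(n_0,a,n_0')$; - $G\to_U G'$: only the root may change, to an arbitrary node; - $G\to_{\phi?}G'$: $G'=G$ and $G\models\phi$; - $G\to_n G'$: a new node with empty label set and no incident edges is added; - $G\to_{\vec{n}}G'$: as for $n$, and the root becomes the new node; - $G\to_{\omega:=_g\phi}G'$: for every node $m$, the new label set of $m$ is $\mathcal{L}^n(m)\cup\{\omega\}$ if $G_m\models\phi$ and $\mathcal{L}^n(m)\setminus\{\omega\}$ otherwise; - $G\to_{\omega:=_l\phi}G'$: the same, but only for the node $m=n_0$; - $G\to_{a+(\phi,\psi)}G'$: edges $(m,a,m')$ are added for all $m,m'$ with $G_m\models\phi$ and $G_{m'}\models\psi$; - $G\to_{a-(\phi,\psi)}G'$: all edges $(m,a,m')$ with $G_m\models\phi$ and $G_{m'}\models\psi$ are deleted; - $\to_{\alpha;\beta}$ is relational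 composition (first $\alpha$, then $\beta$), $\to_{\alpha\cup\beta}$ is union, $\to_{\alpha^\star}$ is the reflexive transitive closure of $\to_\alpha$. $\mathcal{C}\models\phi$ means $G\models\phi$ for every $G\in\mathcal{C}$. *)

(* Defs.v *)
From mathcomp Require Import all_boot.
From Stdlib Require Import Relation_Operators.

Set Implicit Arguments.
Unset Strict Implicit.
Unset Printing Implicit Defensive.

(* F is the set of edge labels, W the set of node labels. *)

Definition countably_infinite (T : Type) : Prop :=
  exists f : nat -> T, bijective f.

Inductive action (F W : Type) : Type :=
| Follow of F
| Jump                                              (* U *)
| New                                               (* n *)
| NewRoot                                           (* n with an arrow *)
| Test of formula F W
| SetGlobal of W & formula F W                      (* w :=_g phi *)
| SetLocal of W & formula F W                       (* w :=_l phi *)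
| AddEdges of F & formula F W & formula F W         (* a + (phi, psi) *)
| DelEdges of F & formula F W & formula F W         (* a - (phi, psi) *)
| Seq of action F W & action F W
| Choice of action F W & action F W
| Star of action F W
with formula (F W : Type) : Type :=
| Lab of W
| Bot
| Neg of formula F W
| Or of formula F W & formula F W
| Box of action F W & formula F W.

Arguments Jump {F W}.
Arguments New {F W}.
Arguments NewRoot {F W}.
Arguments Bot {F W}.

Definition And (F W : Type) (phi psi : formula F W) : formula F W :=
  Neg (Or (Neg phi) (Neg psi)).
Definition Imp (F W : Type) (phi psi : formula F W) : formula F W :=
  Or (Neg phi) psi.
Definition Iff (F W : Type) (phi psi : formula F W) : formula F W :=
  And (Imp phi psi) (Imp psi phi).

Definition is_star (F W : Type) (alpha : action F W) : bool :=
  if alpha is Star _ then true else false.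

Definition is_update (F W : Type) (alpha : action F W) : bool :=
  match alpha with
  | New | NewRoot | SetGlobal _ _ | SetLocal _ _
  | AddEdges _ _ _ | DelEdges _ _ _ => true
  | _ => false
  end.

(* Some action satisfying p occurs, at any depth, in the given action
   (possibly the action itself), respectively formula. *)
Fixpoint occurs_act (F W : Type) (p : action F W -> bool)
    (alpha : action F W) : bool :=
  p alpha ||
  match alpha with
  | Follow _ | Jump | New | NewRoot => false
  | Test phi | SetGlobal _ phi | SetLocal _ phi => occurs p phi
  | AddEdges _ phi psi | DelEdges _ phi psi => occurs p phi || occurs p psi
  | Seq beta gamma | Choice beta gamma =>
      occurs_act p beta || occurs_act p gamma
  | Star beta => occurs_act p beta
  end
with occurs (F W : Type) (p : action F W -> bool) (phi : formula F W) : bool :=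
  match phi with
  | Lab _ | Bot => false
  | Neg psi => occurs p psi
  | Or psi chi => occurs p psi || occurs p chi
  | Box alpha psi => occurs_act p alpha || occurs p psi
  end.

Definition star_free (F W : Type) (phi : formula F W) : Prop :=
  ~~ occurs (@is_star F W) phi.

Definition update_free (F W : Type) (phi : formula F W) : Prop :=
  ~~ occurs (@is_update F W) phi.

Record termgraph (F W : Type) : Type := Termgraph {
  node : Type;
  edge : Type;
  node_label : node -> W -> Prop;
  edge_label : edge -> F;
  source : edge -> node;
  target : edge -> node;
  root : node
}.

Definition reroot (F W : Type) (G : termgraph F W) (m : node G) :
    termgraph F W :=
  Termgraph (@node_label F W G) (@edge_label F W G)
    (@source F W G) (@target F W G) m.

Definition has_edge (F W : Type) (G : termgraph F W)
    (m : node G) (a : F) (m' : node G) : Prop :=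
  exists e : edge G, [/\ source e = m, edge_label e = a & target e = m'].

(* The fresh node is None; option provides a node outside node G. *)
Definition add_node (F W : Type) (G : termgraph F W) : termgraph F W :=
  @Termgraph F W (option (node G)) (edge G)
    (fun m w => if m is Some m0 then node_label m0 w else False)
    (@edge_label F W G)
    (fun e => Some (source e)) (fun e => Some (target e))
    (Some (root G)).

Definition set_label (W : Type) (L : W -> Prop) (w : W) (P : Prop) : W -> Prop :=
  fun w' => (P /\ (L w' \/ w' = w)) \/ (~ P /\ (L w' /\ w' <> w)).

Definition set_global (F W : Type) (G : termgraph F W)
    (w : W) (P : node G -> Prop) : termgraph F W :=
  Termgraph (fun m => set_label (node_label m) w (P m))
    (@edge_label F W G) (@source F W G) (@target F W G) (root G).

Definition set_local (F W : Type) (G : termgraph F W)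
    (w : W) (P : node G -> Prop) : termgraph F W :=
  Termgraph
    (fun m w' => (m = root G /\ set_label (node_label m) w (P m) w')
              \/ (m <> root G /\ node_label m w'))
    (@edge_label F W G) (@source F W G) (@target F W G) (root G).

(* Edges form a multigraph: the sum adjoins one new edge for each pair of
   nodes satisfying P and Q, next to any edge already present. *)
Definition add_edges (F W : Type) (G : termgraph F W)
    (a : F) (P Q : node G -> Prop) : termgraph F W :=
  @Termgraph F W (node G)
    (edge G + {mm : node G * node G | P mm.1 /\ Q mm.2})%type
    (@node_label F W G)
    (fun e => match e with inl e0 => edge_label e0 | inr _ => a end)
    (fun e => match e with inl e0 => source e0 | inr mm => (sval mm).1 end)
    (fun e => match e with inl e0 => target e0 | inr mm => (sval mm).2 end)
    (root G).

Definition del_edges (F W : Type) (G : termgraph F W)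
    (a : F) (P Q : node G -> Prop) : termgraph F W :=
  @Termgraph F W (node G)
    {e : edge G | ~ [/\ edge_label e = a, P (source e) & Q (target e)]}
    (@node_label F W G)
    (fun e => edge_label (sval e))
    (fun e => source (sval e)) (fun e => target (sval e))
    (root G).

Fixpoint step (F W : Type) (alpha : action F W) (G G' : termgraph F W) : Prop :=
  match alpha with
  | Follow a => exists2 m, has_edge (root G) a m & G' = reroot m
  | Jump => exists m : node G, G' = reroot m
  | New => G' = add_node G
  | NewRoot => G' = reroot (None : node (add_node G))
  | Test phi => G' = G /\ sat phi G
  | SetGlobal w phi => G' = set_global w (fun m : node G => sat phi (reroot m))
  | SetLocal w phi => G' = set_local w (fun m : node G => sat phi (reroot m))
  | AddEdges a phi psi =>
      G' = add_edges a (fun m : node G => sat phi (reroot m))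
                       (fun m : node G => sat psi (reroot m))
  | DelEdges a phi psi =>
      G' = del_edges a (fun m : node G => sat phi (reroot m))
                       (fun m : node G => sat psi (reroot m))
  | Seq beta gamma => exists2 H, step beta G H & step gamma H G'
  | Choice beta gamma => step beta G G' \/ step gamma G G'
  | Star beta => clos_refl_trans _ (step beta) G G'
  end
with sat (F W : Type) (phi : formula F W) (G : termgraph F W) : Prop :=
  match phi with
  | Lab w => node_label (root G) w
  | Bot => False
  | Neg psi => ~ sat psi G
  | Or psi chi => sat psi G \/ sat chi G
  | Box alpha psi => forall G', step alpha G G' -> sat psi G'
  end.

Definition C_all (F W : Type) : termgraph F W -> Prop := fun _ => True.

Definition valid_in (F W : Type) (C : termgraph F W -> Prop)
    (phi : formula F W) : Prop :=
  forall G, C G -> sat phi G.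

(* Main.v *)
Require Import Defs.
From mathcomp Require Import all_boot.
From Stdlib Require Import Relation_Operators.

Set Implicit Arguments.
Unset Strict Implicit.
Unset Printing Implicit Defensive.

(** Without updates, satisfaction is invariant under bisimulations that are
    total in both directions (totality takes care of the jump [U]).  With a
    local relabelling one can mark the root, so that [[w :=_l T]<a>w] holds in
    an unlabelled graph exactly when the root carries an [a]-loop.  A loop and
    a 2-cycle are totally bisimilar, and only the first satisfies this
    formula. *)

Scheme action_formula_ind := Induction for action Sort Prop
  with formula_action_ind := Induction for formula Sort Prop.
Combined Scheme action_formula_mutind
  from action_formula_ind, formula_action_ind.

Record total_bisimulation (F W : Type) (G H : termgraph F W)
    (Z : node G -> node H -> Prop) : Prop := TotalBisimulation {
  bisim_label : forall m n, Z m n ->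
    forall w, node_label m w <-> node_label n w;
  bisim_forth : forall m n a m', Z m n -> has_edge m a m' ->
    exists2 n', has_edge n a n' & Z m' n';
  bisim_back : forall m n a n', Z m n -> has_edge n a n' ->
    exists2 m', has_edge m a m' & Z m' n';
  bisim_total_l : forall m, exists n, Z m n;
  bisim_total_r : forall n, exists m, Z m n
}.

Lemma total_bisimulation_sym (F W : Type) (G H : termgraph F W)
    (Z : node G -> node H -> Prop) :
  total_bisimulation Z -> total_bisimulation (fun n m => Z m n).
Proof.
case=> lab forth back totl totr; split=> //.
by move=> n m Zmn w; split=> /(lab _ _ Zmn).
- by move=> n m a n'; apply: back.
- by move=> n m a m'; apply: forth.
Qed.

(** The conclusion also asserts that [K] is a rerooting of [G]: an update-free action only moves the
    root, so one fixed [Z] keeps relating the two graphs after every step. *)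
Definition simulates_step (F W : Type) (alpha : action F W) : Prop :=
  forall (G H : termgraph F W) (Z : node G -> node H -> Prop),
  total_bisimulation Z -> forall m n, Z m n ->
  forall K, step alpha (reroot m) K ->
  exists m' n',
    [/\ K = reroot m', Z m' n' & step alpha (reroot n) (reroot n')].

Definition preserves_sat (F W : Type) (phi : formula F W) : Prop :=
  forall (G H : termgraph F W) (Z : node G -> node H -> Prop),
  total_bisimulation Z -> forall m n, Z m n ->
  sat phi (reroot m) -> sat phi (reroot n).

Lemma simulates_step_star (F W : Type) (alpha : action F W) :
  simulates_step alpha -> simulates_step (Star alpha).
Proof.
move=> sim G H Z bisZ m n Zmn K /=.
(* Induction on the closure needs a variable as its starting graph; the equation [defJ] remembers
   that this graph is a rerooting of [G]. *)
have [J defJ] : exists J, J = reroot m by exists (reroot m).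
rewrite -{1}defJ => stepK.
elim: stepK m n Zmn defJ => {J K} [J K stepK|J|J K L _ IH1 _ IH2] m n Zmn defJ.
- move: stepK; rewrite defJ => /(sim _ _ _ bisZ _ _ Zmn) [m' [n' [-> Zmn' st]]].
  by exists m', n'; split=> //; apply: rt_step.
- by exists m, n; split=> //; apply: rt_refl.
- have [m1 [n1 [defK Zmn1 st1]]] := IH1 _ _ Zmn defJ.
  have [m2 [n2 [defL Zmn2 st2]]] := IH2 _ _ Zmn1 defK.
  by exists m2, n2; split=> //; apply: rt_trans st1 st2.
Qed.

(** The two halves need each other: tests call for preservation of formulas, boxes for simulation of
    actions. Preservation in one direction suffices, since [Z] ranges over all total bisimulations
    and may be replaced by its converse. *)
Lemma update_free_bisim_invariant (F W : Type) :
  (forall alpha : action F W,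
     ~~ occurs_act (@is_update F W) alpha -> simulates_step alpha) /\
  (forall phi : formula F W, update_free phi -> preserves_sat phi).
Proof.
rewrite /update_free; apply: action_formula_mutind => //=.
- move=> a _ G H Z bisZ m n Zmn K [m' em ->].
  have [n' en Zmn'] := bisim_forth bisZ Zmn em.
  by exists m', n'; split=> //; exists n'.
- move=> _ G H Z bisZ m n Zmn K [m' ->].
  have [n' Zmn'] := bisim_total_l bisZ m'.
  by exists m', n'; split=> //; exists n'.
- move=> phi IH /IH pres G H Z bisZ m n Zmn K [-> satm].
  by exists m, n; split=> //; split=> //; exact: pres _ _ _ bisZ _ _ Zmn satm.
- move=> alpha IH1 beta IH2; rewrite negb_or => /andP[/IH1 sim1 /IH2 sim2].
  move=> G H Z bisZ m n Zmn K [J st1 st2].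
  have [m1 [n1 [defJ Zmn1 st1']]] := sim1 _ _ _ bisZ _ _ Zmn _ st1.
  rewrite defJ in st2.
  have [m2 [n2 [-> Zmn2 st2']]] := sim2 _ _ _ bisZ _ _ Zmn1 _ st2.
  by exists m2, n2; split=> //; exists (reroot n1).
- move=> alpha IH1 beta IH2; rewrite negb_or => /andP[/IH1 sim1 /IH2 sim2].
  move=> G H Z bisZ m n Zmn K [/(sim1 _ _ _ bisZ _ _ Zmn)|
                              /(sim2 _ _ _ bisZ _ _ Zmn)] [m' [n' [-> ? ?]]].
  + by exists m', n'; split=> //; left.
  + by exists m', n'; split=> //; right.
- by move=> alpha IH /IH; apply: simulates_step_star.
- by move=> w _ G H Z bisZ m n Zmn /(bisim_label bisZ Zmn).
- by move=> _ G H Z bisZ m n Zmn.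
(* Negation reverses the direction of transfer, hence the converse of [Z]. *)
- move=> phi IH /IH pres G H Z bisZ m n Zmn nsat satn; apply: nsat.
  exact: pres _ _ _ (total_bisimulation_sym bisZ) _ _ Zmn satn.
- move=> phi IH1 psi IH2; rewrite negb_or => /andP[/IH1 pres1 /IH2 pres2].
  move=> G H Z bisZ m n Zmn [satm|satm]; [left|right].
  + exact: pres1 _ _ _ bisZ _ _ Zmn satm.
  + exact: pres2 _ _ _ bisZ _ _ Zmn satm.
- move=> alpha IH1 phi IH2; rewrite negb_or => /andP[/IH1 sim /IH2 pres].
  move=> G H Z bisZ m n Zmn satm K st.
  (* A step from [n] has to be answered by one from [m], so the simulation is run along the converse
     of [Z]. *)
  have [n' [m' [-> Zmn' st']]] :=
    sim _ _ _ (total_bisimulation_sym bisZ) _ _ Zmn _ st.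
  exact: pres _ _ _ bisZ _ _ Zmn' (satm _ st').
Qed.

Definition loop_graph (F W : Type) (a : F) : termgraph F W :=
  @Termgraph F W unit unit (fun _ _ => False) (fun _ => a) id id tt.

Definition two_cycle (F W : Type) (a : F) : termgraph F W :=
  @Termgraph F W bool bool (fun _ _ => False) (fun _ => a) id negb true.

(** The full relation works because no node carries a label and every node of either graph has
    exactly one outgoing edge, labelled [a]. *)
Lemma loop_two_cycle_bisimulation (F W : Type) (a : F) :
  @total_bisimulation F W (loop_graph W a) (two_cycle W a) (fun _ _ => True).
Proof.
split=> //=.
- by move=> m n b m' _ [e [_ /= <- _]]; exists (~~ n) => //; exists n.
- by move=> [] n b n' _ [e [_ /= <- _]]; exists tt => //; exists tt.
- by exists true.
Qed.

Definition root_loop_formula (F W : Type) (a : F) (w : W) : formula F W :=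
  Box (SetLocal w (Neg Bot)) (Neg (Box (Follow _ a) (Neg (Lab _ w)))).

Lemma sat_root_loop_loop_graph (F W : Type) (a : F) (w : W) :
  sat (root_loop_formula a w) (loop_graph W a).
Proof.
move=> _ -> nsat; apply: (nsat _ (ex_intro2 _ _ tt _ erefl)); first by exists tt.
by left; split=> //; left; split; [case | right].
Qed.

Lemma sat_root_loop_two_cycle (F W : Type) (a : F) (w : W) :
  ~ sat (root_loop_formula a w) (two_cycle W a).
Proof.
move=> /(_ _ erefl); apply=> _ [m [e [/= -> _ <-]] ->] /=.
(* The successor of the root [true] is [false]: it is not the relabelled node, and its original
   label set is empty. *)
by case=> [[]|[]].
Qed.

Theorem proposition3p2 (F W : Type)
    (hF : countably_infinite F) (hW : countably_infinite W) :
  exists2 phi : formula F W, star_free phi &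
    forall psi : formula F W, star_free psi -> update_free psi ->
      ~ valid_in (@C_all F W) (Iff phi psi).
Proof.
have [[f _] [g _]] := (hF, hW); pose a := f 0; pose w := g 0.
exists (root_loop_formula a w) => // psi _ psi_upd valid.
have inv := (update_free_bisim_invariant F W).2 _ psi_upd _ _ _
  (loop_two_cycle_bisimulation W a) tt true I.
have loop_valid := valid (loop_graph W a) I.
have cycle_valid := valid (two_cycle W a) I.
(* [Iff] unfolds to a negated disjunction of negated implications. The implication to [psi] is used
   in the loop, the one from [psi] in the 2-cycle; [inv] carries [psi] from the first graph to the
   second. *)
apply: loop_valid; left; case=> [|psi_loop].
  by apply; apply: sat_root_loop_loop_graph.
apply: cycle_valid; right; case=> [|]; first by apply; apply: inv.
exact: sat_root_loop_two_cycle.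
Qed.
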